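(* Let $s\ge0$ be an integer, let $\mathbf{a}^1,\dots,\mathbf{a}^k$ be pairwise linearly independent vectors in $\mathbb{R}^n$, and suppose $f\in C^s(\mathbb{R}^n)$ has the form $$f(\mathbf{x})=\sum_{i=1}^kf_i(\mathbf{a}^i\cdot\mathbf{x}),\qquad\mathbf{x}\in\mathbb{R}^n,$$ where $f_i:\mathbb{R}\to\mathbb{R}$, $i=1,\dots,k$, are arbitrary functions. Then there exist functions $g_i\in C^s(\mathbb{R})$, $i=1,\dots,k$, and a polynomial $P(\mathbf{x})$ of degree at most $k-1$ such that $$f(\mathbf{x})=\sum_{i=1}^kg_i(\mathbf{a}^i\cdot\mathbf{x})+P(\mathbf{x}),\qquad\mathbf{x}\in\mathbb{R}^n.$$
   Context: $C^s$ denotes $s$ times continuously differentiable real functions, with $C^0=C$. No regularity (not even measurability) is assumed on the $f_i$. *)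

(* Defs.v *)
From HB Require Import structures.
From mathcomp Require Import all_boot all_order all_algebra.
From mathcomp Require Import all_classical all_reals all_analysis.
(* The notations of mpoly clash with those of the analysis library. *)
From mathcomp Require Import -(notations) mpoly.

Set Implicit Arguments.
Unset Strict Implicit.
Unset Printing Implicit Defensive.

Import Order.TTheory GRing.Theory Num.Theory.
Import numFieldNormedType.Exports.

Local Open Scope classical_set_scope.
Local Open Scope ring_scope.

Definition dot (R : realType) (n : nat) (a x : 'rV[R]_n) : R :=
  \sum_(j < n) a 0 j * x 0 j.

(* All iterated partial derivatives of order at most s exist everywhere and are
   continuous; [delta_mx 0 j] is the j-th vector of the canonical basis. *)
Fixpoint CsRn (R : realType) (n s : nat) (f : 'rV[R]_n -> R) : Prop :=
  continuous f /\
  if s is s'.+1 then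
    forall j : 'I_n,
      (forall x, derivable f x (delta_mx 0 j)) /\
      CsRn s' (fun x => 'D_(delta_mx 0 j) f x)
  else True.

Fixpoint CsR (R : realType) (s : nat) (g : R -> R) : Prop :=
  continuous g /\
  if s is s'.+1 then (forall t, derivable g t 1) /\ CsR s' (derive1 g)
  else True.

(* Main.v *)
Require Import Defs.
From HB Require Import structures.
From mathcomp Require Import all_boot all_order all_algebra.
From mathcomp Require Import all_classical all_reals all_analysis.
From mathcomp Require Import -(notations) mpoly.
From mathcomp Require Import ring.

Set Implicit Arguments.
Unset Strict Implicit.
Unset Printing Implicit Defensive.

Import Order.TTheory GRing.Theory Num.Theory.
Import numFieldNormedType.Exports.

Local Open Scope classical_set_scope.
Local Open Scope ring_scope.

(* Differences along directions orthogonal to the a_i kill every summand, so [f]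
   is annihilated by all [diff b_1 ... diff b_k] with [b_i] orthogonal to [a_i];
   this intrinsic condition is all that is used of the (possibly wild) [f_i].
   Induct on [k]: let [b] be orthogonal to [a_1] but to no other [a_i].  Then the
   derivative of [f] along [b] is annihilated by the remaining directions, hence
   is a sum of ridge functions plus a polynomial; integrating along [b] and
   subtracting, the remainder [r] is constant along [b].  Restricting [r] to the
   line spanned by [a_1] gives [g_1], and [r - g_1(a_1.x)] satisfies Frechet's
   equation of order [k], so, being continuous, it is a polynomial.  When [s = 0]
   one differentiates the average [M x] of [f] over [x, x + b] instead: its
   derivative is [diff b f], and [M - f] is annihilated by the remaining
   directions, so the induction hypothesis applies to it as well. *)

Lemma is_deriveZD (R : realType) (V : normedModType R) (f g : V -> R) (x v : V)
    (df dg c : R) : is_derive x v f df -> is_derive x v g dg ->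
  is_derive x v (fun y => c * f y + g y) (c * df + dg).
Proof. by move=> hf hg; exact: (is_deriveD (is_deriveZ c hf) hg). Qed.

(** * Difference operators annihilating ridge functions *)

Section Annihilated.
Context {R : realType} {n : nat}.
Local Notation V := 'rV[R]_n.
Implicit Types (f g : V -> R) (a b v x : V) (A : seq V).

Lemma dotD a x y : dot a (x + y) = dot a x + dot a y.
Proof. by rewrite -big_split; apply: eq_bigr => j _; rewrite mxE mulrDr. Qed.

Lemma dotZ a (t : R) x : dot a (t *: x) = t * dot a x.
Proof. by rewrite mulr_sumr; apply: eq_bigr => j _; rewrite mxE mulrCA. Qed.

Lemma dotB a x y : dot a (x - y) = dot a x - dot a y.
Proof. by rewrite -scaleN1r dotD dotZ mulN1r. Qed.

Lemma dot0r a : dot a 0 = 0.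
Proof. by rewrite -(scale0r 0) dotZ mul0r. Qed.

Lemma dotC a x : dot a x = dot x a.
Proof. by apply: eq_bigr => j _; rewrite mulrC. Qed.

Lemma dot0l x : dot (0 : V) x = 0.
Proof. by rewrite dotC dot0r. Qed.

Lemma dot_eq0 a : (dot a a == 0) = (a == 0).
Proof.
apply/eqP/eqP => [a0|->]; last exact: dot0r.
apply/rowP => j; rewrite mxE; apply/eqP; rewrite -sqrf_eq0 expr2.
have /psumr_eq0P-> // : \sum_(j < n) a 0 j * a 0 j = 0 by [].
by move=> i _; rewrite -expr2 sqr_ge0.
Qed.

Definition diff v f : V -> R := fun x => f (x + v) - f x.

(* Intrinsic substitute for being a sum of arbitrary ridge functions with
   directions in [A]. *)
Fixpoint ann A f : Prop :=
  if A is a :: A' then forall b, dot a b = 0 -> ann A' (diff b f)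
  else forall x, f x = 0.

Lemma eq_ann A f g : f =1 g -> ann A f -> ann A g.
Proof. by move=> /funext ->. Qed.

Lemma ann0 A : ann A (fun=> 0).
Proof.
elim: A => [|a A IH] //= b _; apply: eq_ann IH => x.
by rewrite /diff subrr.
Qed.

Lemma annZD A (t : R) f g : ann A f -> ann A g -> ann A (fun x => t * f x + g x).
Proof.
elim: A f g => [|a A IH] f g /= hf hg.
  by move=> x; rewrite hf hg mulr0 addr0.
move=> b ab; apply: eq_ann (IH _ _ (hf b ab) (hg b ab)) => x.
by rewrite /diff; ring.
Qed.

Lemma annZ A (t : R) f : ann A f -> ann A (fun x => t * f x).
Proof.
by move=> hf; apply: eq_ann (annZD t hf (ann0 A)) => x; rewrite addr0.
Qed.

Lemma annD A f g : ann A f -> ann A g -> ann A (fun x => f x + g x).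
Proof.
by move=> hf hg; apply: eq_ann (annZD 1 hf hg) => x; rewrite mul1r.
Qed.

Lemma annB A f g : ann A f -> ann A g -> ann A (fun x => f x - g x).
Proof.
by move=> hf hg; apply: eq_ann (annZD (-1) hg hf) => x; rewrite mulN1r addrC.
Qed.

Lemma ann_sum A (I : Type) (r : seq I) (F : I -> V -> R) :
  (forall i, ann A (F i)) -> ann A (fun x => \sum_(i <- r) F i x).
Proof.
move=> hF; elim: r => [|i r IH].
  by apply: eq_ann (ann0 A) => x; rewrite big_nil.
by apply: eq_ann (annD (hF i) IH) => x; rewrite big_cons.
Qed.

Lemma ann_shift A v f : ann A f -> ann A (fun x => f (x + v)).
Proof.
elim: A f => [|a A IH] f hf //= b ab.
by apply: eq_ann (IH _ (hf b ab)) => x; rewrite /diff addrAC.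
Qed.

Lemma ann_diff A v f : ann A f -> ann A (diff v f).
Proof. by move=> hf; apply: annB => //; exact: ann_shift. Qed.

Lemma ann_cons a A f : ann A f -> ann (a :: A) f.
Proof. by move=> hf b _; exact: ann_diff. Qed.

(** At [a] itself the difference along an orthogonal vector vanishes; at any other entry it turns
    [g] into another profile, [t |-> g (t + dot a b) - g t], with the same direction. *)
Lemma ann_ridge a A (g : R -> R) : a \in A -> ann A (fun x => g (dot a x)).
Proof.
elim: A g => [|a' A IH] g //=; rewrite inE => /predU1P[->|aA] b ab.
  by apply: eq_ann (ann0 A) => x; rewrite /diff dotD ab addr0 subrr.
apply: eq_ann (IH (fun t => g (t + dot a b) - g t) aA) => x.
by rewrite /diff dotD.
Qed.

(** An iterated difference is a finite combination of translates, so it passes to pointwise limits.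
    Applied to difference quotients, this shows that directional derivatives are annihilated. *)
Lemma ann_lim (T : Type) (F : set_system T) (FF : ProperFilter F) A
    (phi : T -> V -> R) f : (forall t, ann A (phi t)) ->
  (forall x, phi t x @[t --> F] --> f x) -> ann A f.
Proof.
elim: A phi f => [|a A IH] phi f hphi phif /=.
  move=> x; apply: (cvg_unique _ (phif x)) => //.
  have -> : (fun t => phi t x) = cst 0 by apply/funext => t; rewrite hphi.
  exact: cvg_cst.
move=> b ab; apply: (IH (fun t => diff b (phi t))) => [t|x].
  exact: hphi.
exact: cvgB.
Qed.

Lemma is_derive_eq_cst (f : R -> R) (c : R) :
  (forall t : R, is_derive t 1 f c) -> forall t, f t = f 0 + t * c.
Proof.
move=> fc t; have fc' (u : R) : is_derive u 1 (fun t => - c * t + f t) 0.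
  have du : is_derive u (1 : R) (id : R -> R) 1 := is_derive_id _ _.
  apply: (is_derive_eq (is_deriveZD (- c) du (fc u))).
  by rewrite mulr1 addNr.
by have := is_derive_0_is_cst t 0 fc'; rewrite mulr0 add0r => <-; ring.
Qed.

(** Differences in [x] commute with integration in the parameter [t]; the normalisation at [t = 0]
    fixes the constant of integration. *)
Lemma ann_primitive A (phi Phi : R -> V -> R) :
  (forall t, ann A (phi t)) -> (forall x, Phi 0 x = 0) ->
  (forall x (t : R), is_derive t 1 (Phi^~ x) (phi t x)) ->
  forall t, ann A (Phi t).
Proof.
elim: A phi Phi => [|a A IH] phi Phi hphi Phi0 dPhi t /=.
  move=> x; have dx (u : R) : is_derive u 1 (Phi^~ x) 0.
    by have := dPhi x u; rewrite hphi.
  by rewrite (is_derive_eq_cst dx t) Phi0 mulr0 addr0.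
move=> b ab; apply: (IH (fun t => diff b (phi t)) (fun t => diff b (Phi t))).
  by move=> u; exact: hphi.
by move=> x; rewrite /diff !Phi0 subrr.
Qed.

(** Every vector is orthogonal to [0], so a list of [m] zeros admits all directions: all [m]-fold
    differences of [f] vanish, which is Frechet's equation. *)
Definition frechet m f := ann (nseq m 0) f.

Lemma frechetP m f : frechet m.+1 f <-> forall v, frechet m (diff v f).
Proof.
split=> [hf v|hf]; first exact: (hf v (dot0l v)).
by rewrite /frechet /= => v _; exact: hf.
Qed.

Lemma frechet_ann A f : frechet (size A) f -> ann A f.
Proof.
by elim: A f => [|a A IH] f //= /frechetP hf b _; exact: IH.
Qed.

(** Nothing changes along [b], so any increment [v] may be corrected by a multiple of [b] until it
    is orthogonal to the head of the list. *)
Lemma ann_invariant_frechet A b h : (forall a, a \in A -> dot a b != 0) ->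
  (forall x (t : R), h (x + t *: b) = h x) -> ann A h -> frechet (size A) h.
Proof.
elim: A h => [|a A IH] h //= Ab hb hA; apply/frechetP => v.
have ab : dot a b != 0 by rewrite Ab ?mem_head.
have -> : diff v h = diff (v - (dot a v / dot a b) *: b) h.
  by apply/funext => x; rewrite /diff addrA -scaleNr hb.
apply: IH => [a' a'A|x t|]; first by rewrite Ab // inE a'A orbT.
  by rewrite /diff addrAC !hb.
by apply: hA; rewrite dotB dotZ divfK // subrr.
Qed.

(* The first hypothesis means [dot a c = 1], unless [a = 0]. *)
Lemma frechet_of_transversal m a c rho :
  (forall x, dot a (x - dot a x *: c) = 0) ->
  (forall v, dot a v = 0 -> frechet m (diff v rho)) ->
  (forall t : R, rho (t *: c) = 0) -> frechet m.+1 rho.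
Proof.
move=> ac; elim: m rho => [|m IH] rho hrho rho0; apply/frechetP.
  suff rhoE x : rho x = 0 by rewrite /frechet /= => v x; rewrite /diff !rhoE subrr.
  have := hrho _ (ac x) (dot a x *: c); rewrite /diff rho0 subr0.
  by rewrite addrC subrK.
(* The increment [w] is split into a part orthogonal to [a], covered by the hypothesis, and a
   multiple of [c]. The difference along the latter still vanishes on the line of [c], so the
   induction hypothesis applies to it. *)
move=> w; set v := w - dot a w *: c.
have -> : diff w rho = fun x => diff v rho (x + dot a w *: c)
                               + diff (dot a w *: c) rho x.
  have wE x : x + w = x + dot a w *: c + v.
    by rewrite /v -addrA [_ *: c + _]addrC subrK.
  by apply/funext => x; rewrite /diff wE; ring.
apply: annD; first by apply: ann_shift; apply: hrho; exact: ac.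
apply: IH => [u au|t]; last by rewrite /diff -scalerDl !rho0 subrr.
have /frechetP/(_ (dot a w *: c)) := hrho u au.
by apply: eq_ann => x; rewrite /diff [x + u + _]addrAC; ring.
Qed.

End Annihilated.

(** * Primitives of continuous functions *)

Section Calculus.
Context {R : realType}.
Implicit Types (f g : R -> R) (t : R).

Lemma is_derive_continuous f (df : R -> R) :
  (forall t, is_derive t 1 f (df t)) -> continuous f.
Proof.
move=> fdf t; apply/differentiable_continuous/derivable1_diffP.
by have [] := fdf t.
Qed.

Lemma mean_value f (df : R -> R) (h : R) : (forall t, is_derive t 1 f (df t)) ->
  exists2 c, `|c| <= `|h| & f h - f 0 = df c * h.
Proof.
move=> fdf; have fc a b : {within `[a, b], continuous f}.
  exact/continuous_subspaceT/(is_derive_continuous fdf).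
have [h0|h0] := leP 0 h.
  have [c] := @MVT_segment R f df 0 h h0 (fun t _ => fdf t) (fc _ _).
  rewrite in_itv /= subr0 => /andP[c0 ch] ->; exists c => //.
  by rewrite !ger0_norm.
have [c] := @MVT_segment R f df h 0 (ltW h0) (fun t _ => fdf t) (fc _ _).
rewrite in_itv /= => /andP[hc c0] E; exists c.
  by rewrite !ler0_norm ?lerN2 // ltW.
by rewrite -opprB E sub0r mulrN opprK.
Qed.

Lemma eq_cst_of_is_derive0 f (r x : R) :
  (forall t, `|t| < r -> is_derive t 1 f 0) -> `|x| < r -> f x = f 0.
Proof.
move=> f0 xr; have r0 : 0 < r by apply: le_lt_trans xr.
have fc a b : - r < a -> b < r -> {within `[a, b], continuous f}.
  move=> ra br; apply: derivable_within_continuous => y.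
  rewrite in_itv /= => /andP[ay yb]; apply: ex_derive.
  apply: f0; rewrite ltr_norml (lt_le_trans ra) //.
  exact: le_lt_trans br.
have D a b : - r < a -> b < r ->
    forall t, t \in `]a, b[ -> is_derive t 1 f (cst 0 t).
  move=> ra br t; rewrite in_itv /= => /andP[ay yb]; apply: f0.
  by rewrite ltr_norml (lt_trans ra ay) (lt_trans yb).
move: xr; rewrite ltr_norml => /andP[rx xr].
have [x0|x0] := leP 0 x.
  have [||c _] := @MVT_segment R f (cst 0) 0 x x0.
  - by apply: D; rewrite // oppr_lt0.
  - by apply: fc; rewrite // oppr_lt0.
  by rewrite mul0r => /eqP; rewrite subr_eq0 => /eqP.
have [||c _] := @MVT_segment R f (cst 0) x 0 (ltW x0).
- exact: D.
- exact: fc.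
by rewrite mul0r => /eqP; rewrite subr_eq0 => /eqP.
Qed.

Lemma exists_local_primitive g (r : R) : 0 < r -> continuous g ->
  exists2 G : R -> R, G 0 = 0 &
    forall t, `|t| < r -> is_derive t 1 G (g t).
Proof.
move=> r0 gc; pose F x := (\int[lebesgue_measure]_(t in [set` `[- r, x]]) g t)%R.
have dF t : `|t| < r -> is_derive t 1 F (g t).
  rewrite ltr_norml => /andP[rt tr].
  have gi : lebesgue_measure.-integrable `[- r, r] (EFin \o g).
    apply: continuous_compact_integrable; first exact: segment_compact.
    apply: continuous_subspaceT; exact: gc.
  have [dF FE] := continuous_FTC1_closed tr gi rt (gc t).
  by split=> //; rewrite -derive1E.
exists (fun x => F x - F 0); first by rewrite subrr.
move=> t /dF dFt; have := is_deriveB dFt (is_derive_cst (F 0) _ _).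
by rewrite subr0.
Qed.

(** The local primitives on the intervals []- r, r[] all vanish at [0], hence agree where two of
    them are defined; the glued function reads its value at [x] from the interval of radius
    [|x| + 1]. *)
Lemma exists_primitive g : continuous g ->
  exists2 G : R -> R, G 0 = 0 & forall t, is_derive t 1 G (g t).
Proof.
move=> gc.
pose Q (H : R -> R -> R) := forall r, 0 < r -> H r 0 = 0 /\
  forall t, `|t| < r -> is_derive t 1 (H r) (g t).
have [H HP] : exists H, Q H.
  have /choice : forall r : R, exists G : R -> R, 0 < r -> G 0 = 0 /\
      forall t, `|t| < r -> is_derive t 1 G (g t).
    move=> r; have [r0|] := ltP 0 r; last by exists (cst 0).
    by have [G G0 GP] := exists_local_primitive r0 gc; exists G.
  by move=> [H HP]; exists H.
have HE r x : `|x| < r -> H (`|x| + 1) x = H r x.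
  move=> xr; have r0 : 0 < r by apply: le_lt_trans xr.
  have x0 : 0 < `|x| + 1 by rewrite ltr_pwDr.
  have [[H0 D] [K0 D']] := (HP _ r0, HP _ x0).
  suff : H r x - H (`|x| + 1) x = H r 0 - H (`|x| + 1) 0.
    by rewrite H0 K0 subrr => /eqP; rewrite subr_eq0 => /eqP.
  apply: (@eq_cst_of_is_derive0 (fun y => H r y - H (`|x| + 1) y)
    (Num.min r (`|x| + 1))).
    move=> t; rewrite lt_min => /andP[tr tx].
    by have := is_deriveB (D _ tr) (D' _ tx); rewrite subrr.
  by rewrite lt_min xr ltrDl ltr01.
exists (fun x => H (`|x| + 1) x); first by rewrite (HP _ _).1 // normr0 add0r.
move=> t; have t0 : 0 < `|t| + 1 by rewrite ltr_pwDr.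
have [_ /(_ t)] := HP _ t0; rewrite ltrDl => /(_ ltr01) [dH HD].
have E : {near t, H (`|t| + 1) =1 (fun x => H (`|x| + 1) x)}.
  near=> y; apply/esym/HE.
  near: y; have := @norm_continuous _ _ t; move=> /cvgr_lt; apply.
  by rewrite ltrDl.
split; first exact: near_eq_derivable E dH.
by rewrite -HD; apply/esym/near_eq_derive.
Unshelve. all: by end_near. Qed.

End Calculus.

(** * Directional derivatives *)

Section DirectionalDerivative.
Context {R : realType} {n : nat}.
Local Notation V := 'rV[R]_n.
Implicit Types (f g : V -> R) (a b v x : V).

Lemma dot_continuous a : continuous (dot a).
Proof.
rewrite (_ : dot a = \sum_(j < n) (fun x : V => a 0 j * x 0 j)); last first.
  by apply/funext => x; rewrite fct_sumE.
elim/big_ind : _ => [|F G FC GC x|j _ x]; first exact: cst_continuous.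
  by apply: continuousD; [exact: FC|exact: GC].
apply: continuousM; first exact: cst_continuous.
exact: coord_continuous.
Qed.

Lemma line_continuous x v : continuous (fun t : R => x + t *: v).
Proof.
move=> t; apply: cvgD; first exact: cvg_cst.
exact: scalel_continuous.
Qed.

Lemma translation_continuous v : continuous (fun x : V => x + v).
Proof.
move=> x; apply: (@cvgD _ _ _ (nbhs x) _ id (cst v)); first exact: id.
exact: cvg_cst.
Qed.

Lemma is_derive_line f x v (t d : R) :
  is_derive (x + t *: v) v f d <->
  is_derive t (1 : R) (fun u : R => f (x + u *: v)) d.
Proof.
have E : (fun h : R => h^-1 *: ((f \o shift (x + t *: v)) (h *: v) - f (x + t *: v)))
    = (fun h => h^-1 *: (((fun u : R => f (x + u *: v)) \o shift t) (h *: (1 : R)) -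
                 f (x + t *: v))).
  apply/funext => h /=; congr (_ *: (f _ - _)).
  by rewrite [h *: 1]mulr1 scalerDl addrCA.
by split=> -[D <-]; split; move: D; rewrite /derivable /derive E.
Qed.

Lemma is_derive_at f x v (d : R) :
  is_derive x v f d <-> is_derive (0 : R) (1 : R) (fun u : R => f (x + u *: v)) d.
Proof. by rewrite -is_derive_line scale0r addr0. Qed.

Definition has_dd v f g := forall x, is_derive x v f (g x).

Lemma has_dd_line v f g x : has_dd v f g ->
  forall t : R, is_derive t (1 : R) (fun u : R => f (x + u *: v)) (g (x + t *: v)).
Proof. by move=> fg t; apply/is_derive_line. Qed.

Lemma has_ddZD v f f' g g' (c : R) : has_dd v f f' -> has_dd v g g' ->
  has_dd v (fun x => c * f x + g x) (fun x => c * f' x + g' x).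
Proof. by move=> hf hg x; exact: is_deriveZD. Qed.

Lemma has_dd_cst v (c : R) : has_dd v (fun=> c) (fun=> 0).
Proof. by move=> x; exact: is_derive_cst. Qed.

Lemma has_ddD v f f' g g' : has_dd v f f' -> has_dd v g g' ->
  has_dd v (fun x => f x + g x) (fun x => f' x + g' x).
Proof. by move=> hf hg x; exact: is_deriveD. Qed.

Lemma has_ddB v f f' g g' : has_dd v f f' -> has_dd v g g' ->
  has_dd v (fun x => f x - g x) (fun x => f' x - g' x).
Proof. by move=> hf hg x; exact: is_deriveB. Qed.

Lemma has_dd_sum v (I : Type) (r : seq I) (F G : I -> V -> R) :
  (forall i, has_dd v (F i) (G i)) ->
  has_dd v (fun x => \sum_(i <- r) F i x) (fun x => \sum_(i <- r) G i x).
Proof.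
move=> FG; elim: r => [|i r IH].
  have -> : (fun x => \sum_(i <- [::]) F i x) = (fun=> 0).
    by apply/funext => x; rewrite big_nil.
  by move=> x; rewrite big_nil; exact: is_derive_cst.
have -> : (fun x => \sum_(i <- i :: r) F i x) =
          (fun x => F i x + \sum_(i <- r) F i x).
  by apply/funext => x; rewrite big_cons.
by move=> x; rewrite big_cons; exact: (is_deriveD (FG i x) (IH x)).
Qed.

Lemma has_dd_coordM v f g (j : 'I_n) : has_dd v f g ->
  has_dd v (fun x => x 0 j * f x) (fun x => v 0 j * f x + x 0 j * g x).
Proof.
move=> fg x; have dx : is_derive x v (fun y : V => y 0 j) (v 0 j).
  apply/is_derive_at.
  have -> : (fun u : R => (x + u *: v) 0 j) =
      (fun u => v 0 j * id u + cst (x 0 j) u).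
    by apply/funext => u; rewrite !mxE addrC mulrC.
  have d0 : is_derive (0 : R) (1 : R) (id : R -> R) 1 := is_derive_id _ _.
  apply: (is_derive_eq (is_deriveZD _ d0 (is_derive_cst _ _ _))).
  by rewrite mulr1 addr0.
apply: (is_derive_eq (is_deriveM dx (fg x))).
by rewrite addrC [f x *: _]mulrC.
Qed.

Lemma has_dd_ridge a v (G g : R -> R) : (forall t : R, is_derive t 1 G (g t)) ->
  has_dd v (fun x => G (dot a x)) (fun x => dot a v * g (dot a x)).
Proof.
move=> Gg x; apply/is_derive_at.
have d0 : is_derive (0 : R) (1 : R) (id : R -> R) 1 := is_derive_id _ _.
have dl := is_deriveZD (dot a v) d0 (is_derive_cst (dot a x) _ _).
have := is_derive1_comp (Gg _) dl.
rewrite /= mulr0 add0r mulr1 addr0 mulrC.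
congr is_derive; apply/funext => u /=.
by rewrite dotD dotZ addrC mulrC.
Qed.

Lemma has_dd_scale v f g (c : R) : has_dd v f g ->
  has_dd (c *: v) f (fun x => c * g x).
Proof.
move=> fg x; apply/is_derive_at.
have d0 : is_derive (0 : R) (1 : R) (id : R -> R) 1 := is_derive_id _ _.
have dl := is_deriveZD c d0 (is_derive_cst 0 _ _).
have := @is_derive1_comp _ (fun w => f (x + w *: v)) (fun y => c * id y + cst 0 y)
  0 _ _ (has_dd_line x fg _) dl.
rewrite /= mulr0 add0r scale0r addr0 mulr1 addr0 mulrC.
congr is_derive; apply/funext => u /=.
by rewrite addr0 scalerA mulrC.
Qed.

(** Mere existence of directional derivatives does not make them additive in the direction; the
    continuity of [h] does. *)
Lemma has_dd_add u v f g h : continuous h ->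
  has_dd u f g -> has_dd v f h -> has_dd (u + v) f (fun x => g x + h x).
Proof.
move=> hc fg fh x.
suff H : (fun t : R => t^-1 *: ((f \o shift x) (t *: (u + v)) - f x)) @ 0^'
    --> g x + h x.
  split; first by apply/cvg_ex; exists (g x + h x).
  exact: cvg_lim H.
(* The increment goes first along [u], then along [v] from the displaced point; by the mean value
   theorem the second quotient is a value of [h] at a point tending to [x]. *)
have E t : t^-1 *: ((f \o shift x) (t *: (u + v)) - f x) =
   t^-1 *: ((f \o shift x) (t *: u) - f x) +
   t^-1 *: (f (t *: u + x + t *: v) - f (t *: u + x)).
  rewrite -scalerDr /=; congr (_ *: _).
  by rewrite scalerDr [_ + _ + x]addrAC; ring.
rewrite (_ : (fun t : R => _) = (fun t => t^-1 *: ((f \o shift x) (t *: u) - f x) +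
   t^-1 *: (f (t *: u + x + t *: v) - f (t *: u + x)))); last exact/funext.
apply: cvgD; first by have [D <-] := fg x; exact: D.
apply/cvgrPdist_lt => e e0.
have hx : \forall y \near x, `|h x - h y| < e.
  by have /cvgrPdist_lt/(_ e e0) := hc x.
have [d d0 hd] := (nbhs_ballP _ _).1 hx.
have small : \forall t \near (0 : R), `|t| * (`|u| + `|v|) < d.
  have : (fun t : R => `|t| * (`|u| + `|v|)) @ (0 : R) --> `|0 : R| * (`|u| + `|v|).
    by apply: cvgM; [exact: norm_continuous|exact: cvg_cst].
  by rewrite normr0 mul0r => /cvgr_lt/(_ _ d0).
near=> t.
have t0 : t != 0 by near: t; exact: nbhs_dnbhs_neq.
have [c ct] := mean_value t (has_dd_line (t *: u + x) fh).
rewrite scale0r addr0 => ->; rewrite [_ *: _]mulrC mulfK //.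
apply: hd; rewrite -ball_normE /=.
rewrite addrAC opprD addrCA subrr addr0 normrN.
apply: le_lt_trans (ler_normD _ _) _; rewrite !normrZ.
apply: (@le_lt_trans _ _ (`|t| * (`|u| + `|v|)));
  last by near: t; exact: cvg_within small.
by rewrite mulrDr lerD2l ler_wpM2r.
Unshelve. all: by end_near. Qed.

End DirectionalDerivative.

(** * Polynomial functions *)

Lemma continuousZD (R : realType) (T : topologicalType) (c : R) (f g : T -> R) :
  continuous f -> continuous g -> continuous (fun x => c * f x + g x).
Proof.
move=> fc gc x; apply: (@cvgD _ _ _ (nbhs x) _ (fun x => c * f x) g).
  by apply: cvgM; [exact: cvg_cst|exact: fc].
exact: gc.
Qed.

Lemma continuous_sub (R : realType) (T : topologicalType) (f g : T -> R) :
  continuous f -> continuous g -> continuous (fun x => f x - g x).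
Proof.
move=> fc gc x; apply: (@cvgB _ _ _ (nbhs x) _ f g); [exact: fc|exact: gc].
Qed.

Section Polynomials.
Context {R : realType} {n : nat}.
Local Notation V := 'rV[R]_n.
Implicit Types (f g : V -> R) (b v x : V).

(* Polynomial functions of total degree less than [d]. *)
Fixpoint pol d f : Prop :=
  if d is d'.+1 then
    exists (c : R) (F : 'I_n -> V -> R), (forall j, pol d' (F j)) /\
      forall x, f x = c + \sum_j x 0 j * F j x
  else forall x, f x = 0.

Lemma eq_pol d f g : f =1 g -> pol d f -> pol d g.
Proof. by move=> /funext ->. Qed.

Lemma pol0 d : pol d (fun=> 0).
Proof.
elim: d => [//|d IH]; exists 0, (fun _ _ => 0); split=> // x.
by rewrite big1 ?addr0 // => j _; rewrite mulr0.
Qed.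

Lemma pol_cst d (c : R) : pol d.+1 (fun=> c).
Proof.
exists c, (fun _ _ => 0); split=> [j|x]; first exact: pol0.
by rewrite big1 ?addr0 // => j _; rewrite mulr0.
Qed.

Lemma polZD d (t : R) f g : pol d f -> pol d g -> pol d (fun x => t * f x + g x).
Proof.
elim: d f g => [|d IH] f g; first by move=> f0 g0 x; rewrite f0 g0 mulr0 addr0.
move=> [c [F [FP fE]]] [c' [G [GP gE]]].
exists (t * c + c'), (fun j x => t * F j x + G j x); split=> [j|x].
  exact: (IH _ _ (FP j) (GP j)).
rewrite fE gE mulrDr mulr_sumr addrACA -big_split /=; congr (_ + _).
by apply: eq_bigr => j _; ring.
Qed.

Lemma polZ d (t : R) f : pol d f -> pol d (fun x => t * f x).
Proof.
by move=> fP; apply: eq_pol (polZD t fP (pol0 d)) => x; rewrite addr0.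
Qed.

Lemma polD d f g : pol d f -> pol d g -> pol d (fun x => f x + g x).
Proof.
by move=> fP gP; apply: eq_pol (polZD 1 fP gP) => x; rewrite mul1r.
Qed.

Lemma polB d f g : pol d f -> pol d g -> pol d (fun x => f x - g x).
Proof.
by move=> fP gP; apply: eq_pol (polZD (-1) gP fP) => x; rewrite mulN1r addrC.
Qed.

Lemma pol_sum d (I : Type) (r : seq I) (F : I -> V -> R) :
  (forall i, pol d (F i)) -> pol d (fun x => \sum_(i <- r) F i x).
Proof.
move=> FP; elim: r => [|i r IH].
  by apply: eq_pol (pol0 d) => x; rewrite big_nil.
by apply: eq_pol (polD (FP i) IH) => x; rewrite big_cons.
Qed.

Lemma polW d f : pol d f -> pol d.+1 f.
Proof.
elim: d f => [|d IH] f.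
  by move=> f0; apply: eq_pol (pol0 1) => x; rewrite f0.
by move=> [c [F [FP fE]]]; exists c, F; split=> // j; exact: (IH _ (FP j)).
Qed.

Lemma pol_coordM d f (j : 'I_n) : pol d f -> pol d.+1 (fun x => x 0 j * f x).
Proof.
move=> fP; exists 0, (fun i x => (i == j)%:R * f x); split=> [i|x].
  exact: (polZ _ fP).
rewrite add0r (bigD1 j) //= eqxx mul1r big1 ?addr0 // => i /negPf ->.
by rewrite mul0r mulr0.
Qed.

Lemma pol_shift d v f : pol d f -> pol d (fun x => f (x + v)).
Proof.
elim: d f => [|d IH] f; first by move=> f0 x; rewrite f0.
move=> [c [F [FP fE]]].
apply: eq_pol (polD (pol_cst d c) (pol_sum (index_enum 'I_n) (F := fun j x =>
   v 0 j * F j (x + v) + x 0 j * F j (x + v)) _)) => [x|j].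
  rewrite fE; congr (_ + _); apply: eq_bigr => j _.
  by rewrite mxE; ring.
by apply: polZD; [apply: polW|apply: pol_coordM]; exact: (IH _ (FP j)).
Qed.

Lemma pol1 f : pol 1 f -> exists c : R, f = fun=> c.
Proof.
move=> [c [F [F0 fE]]]; exists c; apply/funext => x.
by rewrite fE big1 ?addr0 // => j _; rewrite F0 mulr0.
Qed.

Lemma pol_diff d v f : pol d.+1 f -> pol d (diff v f).
Proof.
elim: d f => [|d IH] f.
  by move=> /pol1[c ->] x; rewrite /diff subrr.
move=> [c [F [FP fE]]].
(* Product rule for differences: in one term the coordinate moves, in the other [F j] does. *)
apply: eq_pol (pol_sum (index_enum 'I_n) (F := fun j x =>
   v 0 j * F j (x + v) + x 0 j * diff v (F j) x) _) => [x|j].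
  rewrite /diff !fE opprD addrACA subrr add0r -sumrB; apply: eq_bigr => j _.
  by rewrite mxE; ring.
by apply: polZD; [exact: pol_shift|apply: pol_coordM; exact: (IH _ (FP j))].
Qed.

Lemma pol_frechet d f : pol d f -> frechet d f.
Proof.
elim: d f => [//|d IH] f fP; apply/frechetP => v.
by apply: IH; exact: pol_diff.
Qed.

Lemma pol_dd d v f : pol d.+1 f -> exists2 g, has_dd v f g & pol d g.
Proof.
elim: d f => [|d IH] f.
  by move=> /pol1[c ->]; exists (fun=> 0) => //; exact: has_dd_cst.
move=> [c [F [FP fE]]].
have /choice[G GP] j : exists g, has_dd v (F j) g /\ pol d g.
  by have [g g1 g2] := IH _ (FP j); exists g.
exists (fun x => 0 + \sum_j (v 0 j * F j x + x 0 j * G j x)).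
  rewrite (funext fE); apply: has_ddD; first exact: has_dd_cst.
  by apply: has_dd_sum => j; apply: has_dd_coordM; have [] := GP j.
apply: polD; first exact: pol0.
apply: pol_sum => j; apply: polZD; first exact: FP.
by apply: pol_coordM; have [] := GP j.
Qed.

Lemma pol_coordXM d i f (j : 'I_n) :
  pol d f -> pol (d + i) (fun x => x 0 j ^+ i * f x).
Proof.
elim: i => [|i IH] fP.
  by rewrite addn0; apply: eq_pol fP => x; rewrite mul1r.
rewrite addnS; apply: eq_pol (pol_coordM j (IH fP)) => x.
by rewrite exprS mulrA.
Qed.

Lemma has_dd_coordXM v f g (j : 'I_n) i : has_dd v f g ->
  has_dd v (fun x => x 0 j ^+ i.+1 * f x)
    (fun x => i.+1%:R * v 0 j * (x 0 j ^+ i * f x) + x 0 j ^+ i.+1 * g x).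
Proof.
move=> fg; elim: i => [|i IH] x.
  have := has_dd_coordM j fg x; congr is_derive.
  by rewrite expr0 !mul1r expr1.
have := has_dd_coordM j IH x; congr is_derive.
  by apply/funext => y; rewrite [in RHS]exprS mulrA.
by rewrite /= -[in RHS]natr1 !exprS; ring.
Qed.

(* Repeated integration by parts: each step differentiates [f] once more along
   [b], which lowers its degree. *)
Lemma pol_coordXM_primitive d b (j : 'I_n) i f : b 0 j != 0 -> pol d f ->
  exists2 Q, pol (d + i.+1) Q & has_dd b Q (fun x => x 0 j ^+ i * f x).
Proof.
move=> bj; elim: d f i => [|d IH] f i fP.
  exists (fun=> 0); first exact: pol0.
  rewrite (_ : (fun x => _) = (fun=> 0)); first exact: has_dd_cst.
  by apply/funext => x; rewrite fP mulr0.
have [g fg gP] := pol_dd b fP.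
have [Q QP dQ] := IH g i.+1 gP.
(* The derivative of [x_j^(i+1) f] along [b] is [(i+1) b_j x_j^i f + x_j^(i+1) g]. The primitive [Q]
   of the second term is subtracted and the constant factor of the first is divided out. *)
exists (fun x => (i.+1%:R * b 0 j)^-1 * (x 0 j ^+ i.+1 * f x - Q x)).
  apply: polZ; apply: polB; first exact: pol_coordXM.
  by rewrite addSnnS.
have := has_ddZD (i.+1%:R * b 0 j)^-1 (has_ddB (has_dd_coordXM j i fg) dQ)
  (has_dd_cst b 0).
rewrite /has_dd => H x; have := H x; congr is_derive.
  by apply/funext => y; rewrite addr0.
rewrite addr0 addrK mulKf // mulf_neq0 // pnatr_eq0 //.
Qed.

Lemma pol_primitive d b f : b != 0 -> pol d f ->
  exists2 Q, pol d.+1 Q & has_dd b Q f.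
Proof.
move=> b0 fP; have [j bj] : exists j, b 0 j != 0.
  apply/existsP; apply: contraNT b0; rewrite negb_exists => /forallP b0.
  by apply/eqP/rowP => j; rewrite mxE; have := b0 j; rewrite negbK => /eqP.
have [Q QP dQ] := pol_coordXM_primitive 0 bj fP.
exists Q; first by rewrite -addn1.
by move=> x; have := dQ x; rewrite mul1r.
Qed.

Lemma pol_continuous d f : pol d f -> continuous f.
Proof.
elim: d f => [|d IH] f fP.
  by rewrite (funext fP); exact: cst_continuous.
have [c [F [FP fE]]] := fP; rewrite (funext fE).
have : continuous (fun x => \sum_j x 0 j * F j x).
  rewrite (_ : (fun x => _) = \sum_j (fun x : V => x 0 j * F j x)); last first.
    by apply/funext => x; rewrite fct_sumE.
  elim/big_ind : _ => [|F' G FC GC x|j _ x]; first exact: cst_continuous.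
    by apply: continuousD; [exact: FC|exact: GC].
  by apply: continuousM; [exact: coord_continuous|exact: (IH _ (FP j))].
have cc : continuous (fun _ : V => c) by exact: cst_continuous.
move=> Fc; have := @continuousZD _ _ 1 _ _ cc Fc.
by congr (continuous _); apply/funext => x; rewrite mul1r.
Qed.

Lemma pol_mpoly d f : pol d f -> exists P : mpoly n R,
  (msize P <= d)%N /\ forall x, f x = meval (fun j : 'I_n => x 0 j) P.
Proof.
elim: d f => [|d IH] f.
  by move=> f0; exists 0; rewrite msize0; split=> // x; rewrite f0 meval0.
move=> [c [F [FP fE]]].
have /choice[P PP] j := IH _ (FP j).
exists (mpolyC n c + \sum_j mpolyX R (mnm1 j) * P j); split=> [|x].
  apply: leq_trans (msizeD_le _ _) _; rewrite geq_max; apply/andP; split.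
    by rewrite msizeC; case: (c != 0).
  apply: leq_trans (msize_sum _ _ _) _; apply/bigmax_leqP => j _.
  (* A zero [P j] is set apart because the size formula for a product holds for nonzero factors. *)
  have [->|Pj0] := eqVneq (P j) 0; first by rewrite mulr0 msize0.
  by rewrite msizeM -?msize_poly_eq0 ?msizeX ?mdeg1 ?msize_poly_eq0 //;
    have [] := PP j.
rewrite fE mevalD mevalC raddf_sum; congr (_ + _).
apply: eq_bigr => j _; rewrite /= mevalM mevalXU; congr (_ * _).
by have [_ ->] := PP j.
Qed.

End Polynomials.

(** * Averages along a segment and Frechet's equation *)

Section Averaging.
Context {R : realType} {n : nat}.
Local Notation V := 'rV[R]_n.
Implicit Types (f g h : V -> R) (b v x : V).

Lemma is_derive_translate (G g : R -> R) (u t : R) :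
  (forall t : R, is_derive t 1 G (g t)) ->
  is_derive t 1 (fun s : R => G (u + s)) (g (u + t)).
Proof.
move=> Gg; have d0 : is_derive t (1 : R) (id : R -> R) 1 := is_derive_id _ _.
have dl := is_deriveZD 1 d0 (is_derive_cst u _ _).
have := @is_derive1_comp _ G _ t _ _ (Gg _) dl.
rewrite /= mul1r addr0 !mulr1 addrC.
by congr is_derive; apply/funext => s /=; rewrite mul1r addrC.
Qed.

(** Compactness of [[-1, 1]] makes the continuity of [f] uniform in the displacement [c]; the
    continuity of averages rests on this. *)
Lemma near_segment_translates f b x (e : R) : continuous f -> 0 < e ->
  \forall y \near x, forall c : R, `|c| <= 1 ->
    `|f (y + c *: b) - f (x + c *: b)| < e.
Proof.
move=> fc e0.
pose P (y : V) (c : R) := `|f (y + c *: b) - f (x + c *: b)| < e.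
have cov := (compact_near_coveringP _).1 (@segment_compact R (-1) 1).
have Pcov : \forall y \near x, `[(-1 : R), 1] `<=` P y.
  apply: (cov V (nbhs x) P _) => c _.
  have fxc : \forall z \near x + c *: b, `|f (x + c *: b) - f z| < e / 2.
    by have /cvgrPdist_lt/(_ (e / 2)) := fc (x + c *: b); apply; rewrite divr_gt0.
  have H1 : (fun p : R * V => p.2 + p.1 *: b) @ (c, x) --> x + c *: b.
    apply: cvgD; first exact: cvg_snd.
    by apply: cvgZr_tmp; exact: cvg_fst.
  have H2 : (fun p : R * V => x + p.1 *: b) @ (c, x) --> x + c *: b.
    apply: cvgD; first exact: cvg_cst.
    by apply: cvgZr_tmp; exact: cvg_fst.
  have N1 := H1 _ fxc; have N2 := H2 _ fxc.
  have : \forall p \near (c, x), P p.2 p.1.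
    near=> p; rewrite /P.
    have p1 : `|f (x + c *: b) - f (p.2 + p.1 *: b)| < e / 2 by near: p.
    have p2 : `|f (x + c *: b) - f (x + p.1 *: b)| < e / 2 by near: p.
    rewrite [e]splitr; apply: le_lt_trans (ltrD p1 p2).
    rewrite [X in _ <= X + _]distrC; exact: ler_distD.
  by [].
apply: filterS Pcov => y Py c c1; apply: Py.
by rewrite /= in_itv /= -ler_norml.
Unshelve. all: by end_near. Qed.

(** [M x] is the integral of [f (x + t *: b)] over [t] in [[0, 1]], taken as the value at [1] of a
    primitive normalised at [0]. *)
Lemma exists_average f b : continuous f ->
  exists M : V -> R, [/\ continuous M, has_dd b M (diff b f) &
    forall A, (forall t : R, ann A (diff (t *: b) f)) ->
              ann A (fun x => M x - f x)].
Proof.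
move=> fc.
have /choice[I IP] : forall x, exists G : R -> R, G 0 = 0 /\
    forall t : R, is_derive t 1 G (f (x + t *: b)).
  move=> x; have [|G G0 dG] := @exists_primitive R (fun t => f (x + t *: b)).
    move=> t; apply: continuous_comp; first exact: line_continuous.
    exact: fc.
  by exists G.
exists (fun x => I x 1); split.
- move=> x; apply/(@cvgrPdist_lt _ _ _ (nbhs x)) => e e0.
  have := near_segment_translates b x fc e0; apply: filterS => y fxy.
  have dxy t : is_derive t (1 : R) (fun s => I y s - I x s)
      (f (y + t *: b) - f (x + t *: b)).
    exact: (is_deriveB ((IP y).2 t) ((IP x).2 t)).
  have [c] := mean_value 1 dxy; rewrite normr1 (IP x).1 (IP y).1 subrr subr0 mulr1.
  by move=> c1 E; rewrite distrC E; exact: fxy.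
- move=> x; apply/is_derive_at.
  (* As functions of [s], [I (x + u *: b) s] and [I x (u + s) - I x u] have the same derivative, and
     both vanish at [0]. *)
  have E u : I (x + u *: b) 1 = I x (u + 1) - I x u.
    have D t : is_derive t (1 : R)
        (fun s => I (x + u *: b) s - (I x (u + s) - I x u)) 0.
      have dt := is_derive_translate u t (IP x).2.
      have := is_deriveB ((IP (x + u *: b)).2 t)
        (is_deriveB dt (is_derive_cst (I x u) _ _)).
      congr is_derive.
      by rewrite subr0 scalerDl addrA subrr.
    have := is_derive_eq_cst D 1.
    rewrite mulr0 (IP _).1 !addr0 subrr subrr => /eqP.
    by rewrite subr_eq0 => /eqP.
  rewrite (funext E).
  have d1 := is_derive_translate 1 0 (IP x).2.
  have := is_deriveB d1 ((IP x).2 0).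
  rewrite addr0 scale1r scale0r addr0; congr is_derive.
  by apply/funext => u /=; rewrite [u + 1]addrC.
(* Integrating [diff (t *: b) f x] in [t] from [0] gives [I x t - f x * t], whose value at [1] is
   [M x - f x]. *)
- move=> A hA; have := @ann_primitive R n A (fun t => diff (t *: b) f)
    (fun t x => - f x * t + I x t) hA _ _ 1.
  move=> H; apply: eq_ann (H _ _) => [x|x|x t].
  + by rewrite mulr1 addrC.
  + by rewrite mulr0 (IP x).1 addr0.
  have d0 : is_derive t (1 : R) (id : R -> R) 1 := is_derive_id _ _.
  have := is_deriveZD (- f x) d0 ((IP x).2 t).
  by rewrite mulr1 addrC.
Qed.

Definition proj (j : 'I_n) x : V := x - x 0 j *: delta_mx 0 j.

Lemma projE j x i : proj j x 0 i = (i != j)%:R * x 0 i.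
Proof.
rewrite !mxE eqxx /=; have [->|_] := eqVneq i j.
  by rewrite mulr1 subrr mul0r.
by rewrite mulr0 subr0 mul1r.
Qed.

Lemma projD j x y : proj j (x + y) = proj j x + proj j y.
Proof. by apply/rowP => i; rewrite [RHS]mxE !projE mxE mulrDr. Qed.

Lemma proj_continuous j : continuous (proj j).
Proof.
move=> x; apply: (@cvgB _ _ _ (nbhs x) _ id); first exact: id.
by apply: cvgZr_tmp; exact: coord_continuous.
Qed.

Lemma pol_proj d j f : pol d f -> pol d (f \o proj j).
Proof.
elim: d f => [|d IH] f; first by move=> f0 x; rewrite /= f0.
move=> [c [F [FP fE]]].
exists c, (fun i x => (i != j)%:R * F i (proj j x)); split=> [i|x].
  exact: (polZ _ (IH _ (FP i))).
rewrite /= fE; congr (_ + _); apply: eq_bigr => i _.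
by rewrite projE; ring.
Qed.

Lemma frechet_proj m j f : frechet m f -> frechet m (f \o proj j).
Proof.
elim: m f => [|m IH] f.
  by rewrite /frechet /= => f0 x; rewrite /= f0.
move=> /frechetP hf; apply/frechetP => v.
have -> : diff v (f \o proj j) = diff (proj j v) f \o proj j.
  by apply/funext => x; rewrite /diff /= projD.
exact: IH.
Qed.

Lemma invariant_of_has_dd0 b r : has_dd b r (fun=> 0) ->
  forall x (t : R), r (x + t *: b) = r x.
Proof.
move=> dr x t; have := is_derive_eq_cst (has_dd_line x dr) t.
by rewrite scale0r addr0 mulr0 addr0.
Qed.

(* Averaging in a coordinate direction shows that [f] differs by a polynomial
   from a function that does not depend on this coordinate; all coordinates are
   then removed one after the other. *)
Lemma continuous_frechet_pol m f : continuous f -> frechet m f -> pol m f.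
Proof.
elim: m f => [//|m IH] f fc hf.
have step j h : continuous h -> frechet m.+1 h ->
    pol m.+1 (fun x => h x - h (proj j x)).
  move=> hc /frechetP hh; set e : V := delta_mx 0 j.
  have e0 : e != 0.
    apply/eqP => /rowP/(_ j); rewrite !mxE !eqxx => /eqP.
    by rewrite oner_eq0.
  have [M [Mc dM MA]] := exists_average e hc.
  have MP : pol m (fun x => M x - h x).
    apply: IH; last by apply: (MA (nseq m 0)) => t; exact: hh.
    exact: continuous_sub.
  have dP : pol m (diff e h).
    apply: IH => //; apply: continuous_sub => // x.
    apply: (@continuous_comp _ _ _ (fun x => x + e) h); last exact: hc.
    exact: translation_continuous.
  have [Q QP dQ] := pol_primitive e0 dP.
  have dr : has_dd e (fun x => M x - Q x) (fun=> 0).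
    by move=> x; have := has_ddB dM dQ x; rewrite subrr.
  have rE x : M (proj j x) - Q (proj j x) = M x - Q x.
    by rewrite /proj -scaleNr (invariant_of_has_dd0 dr).
  (* Since [h = (M - Q) + (Q - (M - h))] and [M - Q] is unchanged by [proj j], only the polynomial
     second part contributes to [h - h \o proj j]. *)
  have qP : pol m.+1 (fun x => Q x - (M x - h x)).
    by apply: polB => //; exact: polW.
  apply: eq_pol (polB qP (pol_proj j qP)) => x /=.
  have := rE x => E.
  have -> : M x = M (proj j x) - Q (proj j x) + Q x by rewrite E subrK.
  by ring.
have H (s : seq 'I_n) h : continuous h -> frechet m.+1 h ->
    pol m.+1 (fun x => h x - h (foldr proj x s)).
  elim: s h => [|j s IHs] h hc hh.
    by apply: eq_pol (pol0 m.+1) => x; rewrite subrr.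
  have pc : continuous (h \o proj j).
    by move=> x; apply: continuous_comp; [exact: proj_continuous|exact: hc].
  apply: eq_pol (polD (step j h hc hh) (IHs _ pc (frechet_proj j hh))) => x /=.
  by ring.
(* Removing all coordinates leads to the origin, so what remains of [f] is the constant [f 0]. *)
have fold0 x : foldr proj x (enum 'I_n) = 0.
  apply/rowP => i; rewrite mxE.
  suff : forall s : seq 'I_n, i \in s -> foldr proj x s 0 i = 0.
    by apply; rewrite mem_enum.
  elim=> [//|j s IHs]; rewrite inE /= projE => /predU1P[->|/IHs ->].
    by rewrite eqxx mul0r.
  by rewrite mulr0.
apply: eq_pol (polD (H (enum 'I_n) f fc hf) (pol_cst m (f 0))) => x.
by rewrite fold0 subrK.
Qed.

End Averaging.

(** * Smooth ridge functions *)

Section Smoothness.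
Context {R : realType} {n : nat}.
Local Notation V := 'rV[R]_n.
Implicit Types (f g h : V -> R) (a b v x : V) (s : nat).

Lemma CsRn_continuous s f : CsRn s f -> continuous f.
Proof. by case: s => [|s] []. Qed.

Lemma CsR_continuous s (g : R -> R) : CsR s g -> continuous g.
Proof. by case: s => [|s] []. Qed.

Lemma CsRnS s f : CsRn s.+1 f <-> continuous f /\
  forall j : 'I_n, exists2 g, has_dd (delta_mx 0 j) f g & CsRn s g.
Proof.
split=> [[fc fD]|[fc fD]]; split=> // j.
  exists (fun x => 'D_(delta_mx 0 j) f x); last exact: (fD j).2.
  by move=> x; apply: derivableP; exact: (fD j).1.
have [g fg gs] := fD j; split=> [x|]; first by have [] := fg x.
suff -> : (fun x => 'D_(delta_mx 0 j) f x) = g by [].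
by apply/funext => x; have [] := fg x.
Qed.

Lemma CsRS s (g : R -> R) : CsR s.+1 g <-> continuous g /\
  exists2 dg : R -> R, (forall t : R, is_derive t 1 g (dg t)) & CsR s dg.
Proof.
split=> [[gc [gD gs]]|[gc [dg gdg dgs]]]; split=> //.
  exists (derive1 g) => // t; rewrite derive1E; exact: derivableP.
split=> [t|]; first by have [] := gdg t.
suff -> : derive1 g = dg by [].
by apply/funext => t; rewrite derive1E; have [] := gdg t.
Qed.

Lemma CsR_cst s (c : R) : CsR s (fun=> c).
Proof.
elim: s c => [|s IH] c; first by split=> //; exact: cst_continuous.
apply/CsRS; split; first exact: cst_continuous.
by exists (fun=> 0) => // t; exact: is_derive_cst.
Qed.

Lemma CsRZD s (c : R) (f g : R -> R) :
  CsR s f -> CsR s g -> CsR s (fun t => c * f t + g t).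
Proof.
elim: s f g => [|s IH] f g.
  by move=> [fc _] [gc _]; split=> //; exact: continuousZD.
move=> /CsRS[fc [df fdf dfs]] /CsRS[gc [dg gdg dgs]].
apply/CsRS; split; first exact: continuousZD.
exists (fun t => c * df t + dg t); last exact: IH.
by move=> t; exact: is_deriveZD.
Qed.

Lemma CsRW s (g : R -> R) : CsR s.+1 g -> CsR s g.
Proof.
elim: s g => [|s IH] g; first by move=> [gc _]; split.
move=> /CsRS[gc [dg gdg dgs]]; apply/CsRS; split=> //.
by exists dg => //; exact: IH.
Qed.

Lemma CsR_primitive s (g : R -> R) : CsR s g ->
  exists2 G : R -> R, CsR s.+1 G & forall t : R, is_derive t 1 G (g t).
Proof.
move=> gs; have [G _ dG] := exists_primitive (CsR_continuous gs).
exists G => //; apply/CsRS; split; last by exists g.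
exact: is_derive_continuous dG.
Qed.

Lemma CsRnZD s (c : R) f g :
  CsRn s f -> CsRn s g -> CsRn s (fun x => c * f x + g x).
Proof.
elim: s f g => [|s IH] f g.
  by move=> [fc _] [gc _]; split=> //; exact: continuousZD.
move=> /CsRnS[fc fD] /CsRnS[gc gD]; apply/CsRnS; split.
  exact: continuousZD.
move=> j; have [[df fdf dfs] [dg gdg dgs]] := (fD j, gD j).
by exists (fun x => c * df x + dg x); [exact: has_ddZD|exact: IH].
Qed.

Lemma CsRn_pol s d f : pol d f -> CsRn s f.
Proof.
elim: s f => [|s IH] f fP; first by split=> //; exact: pol_continuous fP.
apply/CsRnS; split; first exact: pol_continuous fP.
move=> j; have [g fg gP] := pol_dd (delta_mx 0 j) (polW fP).
by exists g => //; exact: IH.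
Qed.

Lemma CsRnB s f g : CsRn s f -> CsRn s g -> CsRn s (fun x => f x - g x).
Proof.
move=> fs gs; have := CsRnZD (-1) gs fs.
by congr (CsRn s); apply/funext => x; rewrite mulN1r addrC.
Qed.

Lemma CsRn_ridge s a (g : R -> R) : CsR s g -> CsRn s (fun x => g (dot a x)).
Proof.
have ridgec (g' : R -> R) : continuous g' -> continuous (fun x : V => g' (dot a x)).
  move=> gc x; apply: continuous_comp; [exact: dot_continuous|exact: gc].
elim: s g => [|s IH] g; first by move=> [gc _]; split=> //; exact: ridgec.
move=> /CsRS[gc [dg gdg dgs]]; apply/CsRnS; split; first exact: ridgec.
move=> j; exists (fun x => dot a (delta_mx 0 j) * dg (dot a x)).
  exact: has_dd_ridge.
have := CsRnZD (dot a (delta_mx 0 j)) (IH _ dgs) (CsRn_pol s (pol0 0)).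
by congr (CsRn s); apply/funext => x; rewrite addr0.
Qed.

(** [b] is expanded in the canonical basis. Adding two directions requires a continuous derivative
    along one of them, which [CsRn s] supplies even for [s = 0]. *)
Lemma CsRn_dd s f b : CsRn s.+1 f -> exists2 g, has_dd b f g & CsRn s g.
Proof.
move=> /CsRnS[_ fD]; rewrite [b]row_sum_delta.
elim/big_ind : _ => [|u v [g fg gs] [h fh hs]|j _].
- exists (fun=> 0); last exact: CsRn_pol (pol0 0).
  by move=> x; exact: is_derive0.
- exists (fun x => g x + h x).
    exact: has_dd_add (CsRn_continuous hs) fg fh.
  have := CsRnZD 1 gs hs.
  by congr (CsRn s); apply/funext => x; rewrite mul1r.
have [g fg gs] := fD j.
exists (fun x => b 0 j * g x); first exact: has_dd_scale.
have := CsRnZD (b 0 j) gs (CsRn_pol s (pol0 0)).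
by congr (CsRn s); apply/funext => x; rewrite addr0.
Qed.

Lemma CsRn_line s f v : CsRn s f -> CsR s (fun t => f (t *: v)).
Proof.
have linec h : continuous h -> continuous (fun t : R => h (t *: v)).
  move=> hc t; apply: continuous_comp; [exact: scalel_continuous|exact: hc].
elim: s f => [|s IH] f fs.
  by split=> //; apply: linec; exact: CsRn_continuous fs.
have [g fg gs] := CsRn_dd v fs.
apply/CsRS; split; first by apply: linec; exact: CsRn_continuous fs.
exists (fun t => g (t *: v)); last exact: IH.
move=> t; have := has_dd_line 0 fg t; rewrite add0r.
by congr is_derive; apply/funext => u; rewrite add0r.
Qed.

Fixpoint ridge_sum s (A : seq V) f : Prop :=
  if A is a :: A' then
    exists2 g : R -> R, CsR s g & ridge_sum s A' (fun x => f x - g (dot a x))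
  else forall x, f x = 0.

Lemma eq_ridge_sum s A f g : f =1 g -> ridge_sum s A f -> ridge_sum s A g.
Proof. by move=> /funext ->. Qed.

Lemma ridge_sumD s A f g :
  ridge_sum s A f -> ridge_sum s A g -> ridge_sum s A (fun x => f x + g x).
Proof.
elim: A f g => [|a A IH] f g /=; first by move=> f0 g0 x; rewrite f0 g0 addr0.
move=> [u us fu] [w ws gw]; exists (fun t => 1 * u t + w t); first exact: CsRZD.
by apply: eq_ridge_sum (IH _ _ fu gw) => x; ring.
Qed.

Lemma ridge_sum_cons s a A f : ridge_sum s A f -> ridge_sum s (a :: A) f.
Proof.
move=> fA; exists (fun=> 0); first exact: CsR_cst.
by apply: eq_ridge_sum fA => x; rewrite subr0.
Qed.

Lemma ridge_sumW s A f : ridge_sum s.+1 A f -> ridge_sum s A f.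
Proof.
elim: A f => [//|a A IH] f [g gs fg].
by exists g; [exact: CsRW|exact: IH].
Qed.

Lemma ridge_sum_CsRn s A f : ridge_sum s A f -> CsRn s f.
Proof.
elim: A f => [|a A IH] f /=.
  by move=> f0; exact: (@CsRn_pol s 0).
move=> [g gs /IH fg]; have := CsRnZD 1 (CsRn_ridge a gs) fg.
by congr (CsRn s); apply/funext => x; ring.
Qed.

Lemma ridge_sum_ann s A f : ridge_sum s A f -> ann A f.
Proof.
elim: A f => [//|a A IH] f [g gs /IH fg].
have := annD (@ann_cons _ _ a _ _ fg) (ann_ridge g (mem_head a A)).
by apply: (@eq_ann _ _ (a :: A)) => x; rewrite subrK.
Qed.

(** Along [b] a primitive of [g (dot a x)] is [G (dot a x) / dot a b] with [G' = g], so each profile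
    gains one order of smoothness. *)
Lemma ridge_sum_primitive s A b h : (forall a, a \in A -> dot a b != 0) ->
  ridge_sum s A h -> exists2 H, ridge_sum s.+1 A H & has_dd b H h.
Proof.
elim: A h => [|a A IH] h Ab /=.
  move=> h0; exists (fun=> 0) => //.
  by rewrite (funext h0); exact: has_dd_cst.
move=> [g gs hg]; have [|H HA dH] := IH _ _ hg.
  by move=> a' a'A; rewrite Ab // inE a'A orbT.
have ab : dot a b != 0 by rewrite Ab ?mem_head.
have [G Gs dG] := CsR_primitive gs.
exists (fun x => (dot a b)^-1 * G (dot a x) + H x).
  exists (fun t => (dot a b)^-1 * G t + 0); first exact: (CsRZD _ Gs (CsR_cst _ 0)).
  by apply: eq_ridge_sum HA => x; ring.
move=> x; have := has_ddZD (dot a b)^-1 (has_dd_ridge a b dG) dH x.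
by congr is_derive; rewrite mulKf // addrC subrK.
Qed.

End Smoothness.

(** * The decomposition *)

Section RidgeDecomposition.
Context {R : realType} {n : nat}.
Local Notation V := 'rV[R]_n.
Implicit Types (f g h : V -> R) (a b v x : V) (s : nat) (A : seq V).

Lemma exists_notin (r : seq R) : exists t, t \notin r.
Proof.
exists (\sum_(x <- r) `|x| + 1); apply/negP => /[dup] tr.
rewrite -[X in X \in _](@ger0_norm R); last first.
  by rewrite addr_ge0 // sumr_ge0.
rewrite ger0_norm; last by rewrite addr_ge0 // sumr_ge0.
move=> _; set t := _ + 1 in tr.
have : `|t| <= \sum_(x <- r) `|x|.
  by rewrite (big_rem t) //= lerDl sumr_ge0.
rewrite ger0_norm; last by rewrite addr_ge0 // sumr_ge0.
by rewrite /t gerDl ler10.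
Qed.

(** Gram-Schmidt: the component [w] of [a'] orthogonal to [a] satisfies [dot a' w = dot w w], which
    is nonzero by independence. *)
Lemma exists_orthogonal_transversal a a' : free [:: a; a'] ->
  exists2 w, dot a w = 0 & dot a' w != 0.
Proof.
rewrite free_cons span_seq1 seq1_free => /andP[aa' a'0].
have a0 : a != 0 by apply: contraNneq aa' => ->; exact: mem0v.
set mu := dot a a' / dot a a; exists (a' - mu *: a).
  by rewrite dotB dotZ divfK ?subrr // dot_eq0.
set w := a' - mu *: a.
have aw : dot a w = 0 by rewrite dotB dotZ divfK ?subrr // dot_eq0.
have -> : dot a' w = dot w w.
  have -> : dot w w = dot w a' - mu * dot w a by rewrite -dotZ -dotB.
  by rewrite [dot w a]dotC aw mulr0 subr0 dotC.
rewrite dot_eq0 subr_eq0; apply: contraNneq aa' => a'E.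
have mu0 : mu != 0 by apply: contraNneq a'0 => m0; rewrite a'E m0 scale0r.
by apply/vlineP; exists mu^-1; rewrite a'E scalerA mulVf // scale1r.
Qed.

Lemma exists_transversal a A : all (fun a' => free [:: a; a']) A ->
  exists2 b, dot a b = 0 & forall a', a' \in A -> dot a' b != 0.
Proof.
elim: A => [|a' A IH] /=; first by exists 0 => //; exact: dot0r.
move=> /andP[/exists_orthogonal_transversal[w aw a'w] /IH[b ab Ab]].
(* The parameter [t] avoids the finitely many values at which [w + t *: b] becomes orthogonal to an
   entry of [A]. The vector [b] is corrected in this way only if it is orthogonal to [a']. *)
have [t tA] := exists_notin ([seq - dot c w / dot c b | c <- A]).
have [tA0 | t0] := eqVneq (dot a' b) 0.
  exists (w + t *: b); first by rewrite dotD dotZ aw ab mulr0 addr0.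
  move=> c; rewrite inE => /predU1P[->|cA].
    by rewrite dotD dotZ tA0 mulr0 addr0.
  apply: contra tA; rewrite dotD dotZ addrC addr_eq0 => /eqP E.
  by apply/mapP; exists c => //; rewrite -E mulfK // Ab.
by exists b => // c; rewrite inE => /predU1P[->|/Ab].
Qed.

(** The part of the induction common to [s = 0] and [s > 0]: a decomposition of the derivative of
    [h] along [b] is integrated, and the remainder, constant along [b], supplies the profile for
    [a]. *)
Lemma ridge_decomposition_step s a A b h H H' p :
  dot a b = 0 -> (forall a', a' \in A -> dot a' b != 0) ->
  CsRn s h -> ann (a :: A) h ->
  ridge_sum s A H -> has_dd b H H' -> pol (size A) p ->
  has_dd b h (fun x => H' x + p x) ->
  exists2 u, pol (size A).+1 u & ridge_sum s (a :: A) (fun x => h x - u x).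
Proof.
move=> ab Ab hs hA HA dH pP dh.
(* A zero [b] is transversal only to the empty list, and then [pol 0 p] says that [p] vanishes. *)
have [Q QP dQ] : exists2 Q, pol (size A).+1 Q & has_dd b Q p.
  have [b0|b0] := eqVneq b 0; last exact: pol_primitive.
  exists (fun=> 0); first exact: pol0.
  have -> : p = fun=> 0; last exact: has_dd_cst.
  case: A Ab pP {hA HA} => [_ p0|a' A Ab _]; first exact/funext.
  by have := Ab a' (mem_head _ _); rewrite b0 dot0r eqxx.
pose r x := h x - H x - Q x.
have rs : CsRn s r.
  apply: CsRnB; last exact: CsRn_pol QP.
  by apply: CsRnB => //; exact: ridge_sum_CsRn HA.
have rA : ann (a :: A) r.
  apply: (@annB _ _ (a :: A));
    last exact: (@frechet_ann _ _ (a :: A) _ (pol_frechet QP)).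
  by apply: (@annB _ _ (a :: A)) => //; apply: ann_cons; exact: ridge_sum_ann HA.
have rb : forall x (t : R), r (x + t *: b) = r x.
  apply: invariant_of_has_dd0 => x.
  have := has_ddB (has_ddB dh dH) dQ x.
  by congr is_derive; ring.
(* If [a] is nonzero, [dot a c = 1]; if [a = 0], then [c = 0] and the two identities below still
   hold. *)
pose c := (dot a a)^-1 *: a.
have ac t : dot a (t *: c) *: c = t *: c.
  rewrite !dotZ; have [a0|a0] := eqVneq a 0; first by rewrite /c a0 !scaler0.
  by rewrite mulVf ?mulr1 ?dot_eq0.
have ac0 x : dot a (x - dot a x *: c) = 0.
  rewrite dotB !dotZ; have [->|a0] := eqVneq a 0.
    by rewrite !dot0l mul0r subrr.
  by rewrite mulVf ?dot_eq0 // mulr1 subrr.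
pose g t := r (t *: c).
pose rho x := r x - g (dot a x).
have gs : CsR s g by exact: CsRn_line.
(* Along [v] orthogonal to [a], [rho] has the same differences as [r]. These are annihilated by [A]
   and constant along [b], so they satisfy Frechet's equation of order [size A]; as [rho] vanishes
   on the line of [c], it satisfies the equation of the next order. *)
have rhof : frechet (size A).+1 rho.
  apply: (@frechet_of_transversal _ _ _ a c) => // [v av|t]; last first.
    by rewrite /rho /g ac subrr.
  have -> : diff v rho = diff v r.
    by apply/funext => x; rewrite /diff /rho dotD av addr0; ring.
  apply: (@ann_invariant_frechet _ _ A b) => // [x t|]; last exact: rA.
  by rewrite /diff [x + _ + v]addrAC !rb.
have rhop : pol (size A).+1 rho.
  apply: continuous_frechet_pol => //.
  apply: continuous_sub; first exact: (CsRn_continuous rs).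
  exact: (CsRn_continuous (CsRn_ridge a gs)).
exists (fun x => Q x + rho x); first exact: polD.
exists g => //; apply: eq_ridge_sum HA => x.
by rewrite /rho /r; ring.
Qed.

Lemma ridge_decomposition A s f : pairwise (fun a b => free [:: a; b]) A ->
  CsRn s f -> ann A f ->
  exists2 u, pol (size A) u & ridge_sum s A (fun x => f x - u x).
Proof.
elim: A s f => [|a A IH] s f /=.
  by move=> _ _ f0; exists (fun=> 0) => // x; rewrite f0 subrr.
move=> /andP[/exists_transversal[b ab Ab] {}/IH IH] fs fA.
have diffA t : ann A (diff (t *: b) f) by apply: fA; rewrite dotZ ab mulr0.
case: s fs => [|s] fs.
  (* Here [f] need not be differentiable. In [f = (f - M) + M], the induction hypothesis applies to
     [f - M], while [M] has the continuous derivative [diff b f] along [b]. *)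
  have fc : continuous f := CsRn_continuous fs.
  have [M [Mc dM MA]] := exists_average b fc.
  have fMA : ann A (fun x => f x - M x).
    apply: eq_ann (annZ (-1) (MA _ diffA)) => x.
    by rewrite mulN1r opprB.
  have [u1 u1P Hu1] := IH 0%N _ (conj (continuous_sub fc Mc) I) fMA.
  have dc : continuous (diff b f).
    apply: continuous_sub => // x.
    apply: (@continuous_comp _ _ _ (fun x => x + b) f).
      exact: translation_continuous.
    exact: fc.
  have [p pP Hp] := IH 0%N _ (conj dc I) (fA b ab).
  have [H HA dH] := ridge_sum_primitive Ab Hp.
  have MA' : ann (a :: A) M.
    have := @annB _ _ (a :: A) _ _ fA (@ann_cons _ _ a _ _ fMA).
    by apply: (@eq_ann _ _ (a :: A)) => x; ring.
  have [|u2 u2P Hu2] := ridge_decomposition_step ab Ab (conj Mc I : CsRn 0 M)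
    MA' (ridge_sumW HA) dH pP.
    by move=> x; have := dM x; rewrite subrK.
  exists (fun x => u1 x + u2 x).
    by apply: (@polD _ _ (size A).+1) => //; exact: polW.
  apply: eq_ridge_sum (ridge_sumD (@ridge_sum_cons _ _ _ a _ _ Hu1) Hu2) => x.
  by ring.
have [g fg gs] := CsRn_dd b fs.
have gA : ann A g.
  apply: (@ann_lim _ _ _ (0 : R)^' _ _ (fun t x => t^-1 * diff (t *: b) f x)).
    by move=> t; exact: annZ.
  move=> x; have [D <-] := fg x.
  have -> : (fun t => t^-1 * diff (t *: b) f x) =
      (fun t => t^-1 *: ((f \o shift x) (t *: b) - f x)).
    by apply/funext => t; rewrite /diff /= [x + _]addrC.
  exact: D.
have [p pP Hp] := IH s _ gs gA.
have [H HA dH] := ridge_sum_primitive Ab Hp.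
apply: (ridge_decomposition_step ab Ab fs fA HA dH pP) => x.
by have := fg x; rewrite subrK.
Qed.

(** As the indices in [r] are distinct, the profile at the head index can be set without disturbing
    those of the tail. *)
Lemma ridge_sum_bigop (I : eqType) (a : I -> V) (r : seq I) s f : uniq r ->
  ridge_sum s [seq a i | i <- r] f -> exists g : I -> R -> R,
    (forall i, CsR s (g i)) /\ forall x, f x = \sum_(i <- r) g i (dot (a i) x).
Proof.
elim: r f => [|i r IH] f /=.
  move=> _ f0; exists (fun _ _ => 0); split=> [i|x]; first exact: CsR_cst.
  by rewrite big_nil f0.
move=> /andP[ir ur] [g gs /(IH _ ur)[G [Gs GE]]].
exists (fun j => if j == i then g else G j); split=> [j|x].
  by case: eqP.
rewrite big_cons eqxx -[LHS](subrK (g (dot (a i) x))) GE addrC; congr (_ + _).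
apply: eq_big_seq => j jr; case: eqVneq => // ji.
by rewrite -ji jr in ir.
Qed.

End RidgeDecomposition.

(* [msize P] is 1 + the total degree of P, and 0 when P = 0. *)
Theorem theorem2p5 (R : realType) (s n k : nat) (a : 'I_k -> 'rV[R]_n)
    (f : 'rV[R]_n -> R) (fi : 'I_k -> R -> R)
    (ha : forall i j : 'I_k, i != j -> free [:: a i; a j])
    (hf : CsRn s f)
    (hsum : forall x : 'rV[R]_n, f x = \sum_(i < k) fi i (dot (a i) x)) :
  exists (g : 'I_k -> R -> R) (P : mpoly n R),
    [/\ forall i : 'I_k, CsR s (g i),
        (msize P <= k)%N &
        forall x : 'rV[R]_n,
          f x = \sum_(i < k) g i (dot (a i) x)
                + meval (fun j : 'I_n => x 0 j) P].
Proof.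
have pw : pairwise (fun b c => free [:: b; c]) [seq a i | i <- enum 'I_k].
  rewrite pairwise_map; have := enum_uniq 'I_k; rewrite uniq_pairwise.
  by apply: sub_pairwise => i j; exact: ha.
have fA : ann [seq a i | i <- enum 'I_k] f.
  have -> : f = fun x => \sum_(i <- enum 'I_k) fi i (dot (a i) x).
    by apply/funext => x; rewrite hsum big_enum.
  rewrite (_ : (fun x => _) = fun x => \sum_(i < k) fi i (dot (a i) x)); last first.
    by apply/funext => x; rewrite big_enum.
  apply: ann_sum => i; apply: ann_ridge.
  by apply/mapP; exists i; rewrite ?mem_enum.
have [u uP fu] := ridge_decomposition pw hf fA.
have [g [gs gE]] := ridge_sum_bigop (enum_uniq _) fu.
have [P [Pk uE]] := pol_mpoly uP.
exists g, P; split=> // [|x]; first by rewrite size_map size_enum_ord in Pk.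
by rewrite -uE -[LHS](subrK (u x)) gE big_enum.
Qed.
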